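(* Let $n\ge 1$, $\lambda\in\mathbb{C}^n$, $H_2=\sum_{j=1}^n\lambda_jx_jy_j$. For $H=H_2+H_*$, $H_*=\sum_{|\alpha|+|\beta|\ge3}H_{\alpha\beta}x^\alpha y^\beta\in\mathcal{F}$, let $$H_2+N_*,\qquad N_*=\sum_{\langle\lambda,\beta-\alpha\rangle=0,\ |\alpha|+|\beta|\ge3}N_{\alpha\beta}x^\alpha y^\beta$$ be the normal form of $H$. Then for any $(\alpha,\beta)\in\mathbb{Z}_+^{2n}$ with $\langle\lambda,\beta-\alpha\rangle=0$ and $|\alpha|+|\beta|\ge 3$, the coefficient $N_{\alpha\beta}$ is a polynomial in the variables $H_{\alpha'\beta'}$ (with coefficients not depending on $H_*$): $N_{\alpha\beta}=\sum_M c_M M$, where every monomial $M$ in this sum satisfies $$1\le\deg(M)\le|\alpha|+|\beta|-2,$$ $$w(M)-(\alpha,\beta)=T\in\mathbb{Z}_+^{2n},\qquad \delta T=0,\qquad |T|=2\deg(M)-2 .$$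
   Context: $\mathcal{F}$ is the space of formal power series with complex coefficients in $x=(x_1,\dots,x_n)$, $y=(y_1,\dots,y_n)$ all of whose monomials have total degree $\ge3$. For a multiindex, $x^\alpha=x_1^{\alpha_1}\cdots x_n^{\alpha_n}$, $|\alpha|=\alpha_1+\ldots+\alpha_n$ (and $|T|$ is the sum of all entries of $T\in\mathbb{Z}_+^{2n}$); $\langle\lambda,\gamma\rangle=\sum_j\lambda_j\gamma_j$. For $(\alpha,\beta)\in\mathbb{Z}_+^{2n}$ put $\delta(\alpha,\beta)=\beta-\alpha\in\mathbb{Z}^n$. For a monomial $M=c\prod_{j=1}^sH_{\alpha^{(j)}\beta^{(j)}}$ in the coefficients of $H_*$ put $\deg(M)=s$ and $w(M)=\sum_{j=1}^s(\alpha^{(j)},\beta^{(j)})\in\mathbb{Z}_+^{2n}$. Poisson bracket: $\{F_1,F_2\}=\sum_{j=1}^n\bigl(\frac{\partial F_1}{\partial y_j}\frac{\partial F_2}{\partial x_j}-\frac{\partial F_1}{\partial x_j}\frac{\partial F_2}{\partial y_j}\bigr)$. Normal form: let $e^{\{F,\cdot\}}H=H+\frac1{1!}\{F,H\}+\frac1{2!}\{F,\{F,H\}\}+\ldots$ (time-one shift along the flow of the Hamiltonian $F$). The normal form of $H$ is $H_2+N_*=e^{\{F,\cdot\}}H$, where $F\in\mathcal{F}$ is the unique series containing no monomials $x^\alpha y^\beta$ with $\langle\lambda,\alpha-\beta\rangle=0$ for which $N_*\in\mathcal{F}$ contains only resonant monomials, i.e. monomials $x^\alpha y^\beta$ with $\langle\lambda,\beta-\alpha\rangle=0$.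 *)

(* Defs.v *)
From mathcomp Require Import all_boot all_order all_algebra.
From mathcomp Require Import finmap reals complex.
From mathcomp Require Import monalg mpoly.

Set Implicit Arguments.
Unset Strict Implicit.
Unset Printing Implicit Defensive.

Import Order.TTheory GRing.Theory Num.Theory.

Local Open Scope ring_scope.

(* A formal power series in k variables, given by its coefficients. *)
Definition fps (C : Type) (k : nat) : Type := 'X_{1..k} -> C.

Section FormalPowerSeries.
Variables (C : comNzRingType) (k : nat).
Implicit Types F G : fps C k.

Definition fps_add F G : fps C k := fun m => F m + G m.

Definition fps_sub F G : fps C k := fun m => F m - G m.

(* Cauchy product; the bound on the degree of i, needed to have a finite index
   type, is implied by i <= m. *)
Definition fps_mul F G : fps C k := fun m =>
  \sum_(i : 'X_{1..k < (mdeg m).+1} | (i <= m)%MM) F i * G (m - i)%MM.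

Definition fps_deriv (i : 'I_k) F : fps C k := fun m =>
  F (m + U_(i))%MM *+ (m i).+1.

Definition in_calF F : Prop := forall m, (mdeg m < 3)%N -> F m = 0.

End FormalPowerSeries.

(* A pair (alpha, beta) of multiindices of length n is a single multiindex of
   length n + n; the first n variables are the x_j, the last n are the y_j. *)
Definition xvar (n : nat) (j : 'I_n) : 'I_(n + n) := lshift n j.
Definition yvar (n : nat) (j : 'I_n) : 'I_(n + n) := rshift n j.

Definition delta (n : nat) (m : 'X_{1..n + n}) : 'rV[int]_n :=
  \row_j ((m (yvar j))%:Z - (m (xvar j))%:Z).

Section NormalForm.
Variables (R : realType) (n : nat).
Notation C := R[i].
Implicit Types F G H Hs Ns : fps C (n + n).
Implicit Types (lam : 'rV[C]_n) (m : 'X_{1..n + n}).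

Definition poisson F G : fps C (n + n) := fun m =>
  \sum_(j < n)
    fps_sub (fps_mul (fps_deriv (yvar j) F) (fps_deriv (xvar j) G))
            (fps_mul (fps_deriv (xvar j) F) (fps_deriv (yvar j) G)) m.

(* G = e^{F, .} H. Infinite sums of formal series converge coefficientwise, each
   coefficient of the partial sums being eventually constant. *)
Definition is_exp_poisson F H G : Prop :=
  forall m, exists K0 : nat, forall K : nat, (K0 <= K)%N ->
    \sum_(k < K) (k`!%:R)^-1 * iter k (poisson F) H m = G m.

Definition pairing lam (g : 'rV[int]_n) : C := \sum_j lam 0 j * (g 0 j)%:~R.

Definition resonant lam m : bool := pairing lam (delta m) == 0.

Definition H2 lam : fps C (n + n) := fun m =>
  \sum_j lam 0 j *+ (m == U_(xvar j) + U_(yvar j))%MM.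

Definition normalizes lam F Hs Ns : Prop :=
  [/\ in_calF F,
      forall m, resonant lam m -> F m = 0,
      in_calF Ns,
      forall m, ~~ resonant lam m -> Ns m = 0
    & is_exp_poisson F (fps_add (H2 lam) Hs) (fps_add (H2 lam) Ns)].

(* For every lam and Hs in calF such F and Ns exist and are unique, by induction
   on the degree: {x^a y^b, H2} = <lam, b - a> x^a y^b. *)
Definition is_normal_form lam Hs Ns : Prop :=
  exists F, normalizes lam F Hs Ns.

(* The indeterminate indexed by (alpha, beta) stands for the coefficient
   H_(alpha, beta); there are infinitely many of them. *)
Definition Hmonom : choiceType := {cmonom 'X_{1..n + n}}.
Definition Hpoly : Type := {malg C[Hmonom]}.

Definition eval_Hmonom (Hs : fps C (n + n)) (M : Hmonom) : C :=
  \prod_(v <- finsupp M) Hs v ^+ M v.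

Definition eval_Hpoly (Hs : fps C (n + n)) (p : Hpoly) : C :=
  monalg.mmap idfun (eval_Hmonom Hs) p.

Definition weight (M : Hmonom) : 'X_{1..n + n} :=
  (\sum_(v <- finsupp M) v *+ M v)%MM.

End NormalForm.

(* Main.v *)
(** If [f] and [g] are polynomials in the coefficients of [H_*] all of whose
    monomials satisfy the weight condition at [m1] and [m2], then [f * g]
    satisfies it at [m1 + m2 - (x_j y_j)], the exponent of the corresponding
    term of a Poisson bracket: one unit of degree costs one pair [x_j y_j] in
    the excess [T].  So the weight condition is stable under Poisson brackets.
    Since [{F, H_2}] has coefficients [<lambda, delta m> F_m] and every other
    bracket raises the degree, the coefficients of [F], hence those of [N_*],
    satisfy the condition by induction on the degree. *)
Require Import Defs.
From HB Require Import structures.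
From mathcomp Require Import all_boot all_order all_algebra.
From mathcomp Require Import finmap reals complex.
From mathcomp Require Import monalg mpoly.
From mathcomp Require Import zify ring.

Set Implicit Arguments.
Unset Strict Implicit.
Unset Printing Implicit Defensive.

Import GRing.Theory Num.Theory.

Local Open Scope ring_scope.

(** * Monomials in the coefficients of [H_*]: evaluation, weight and degree *)

Section MonomialEvaluation.
Variables (R : realType) (n : nat).
Implicit Types (M : Hmonom n) (v : 'X_{1..n + n}) (D : {fset 'X_{1..n + n}}).

(** Allows two monomials with different supports to be compared over the union of these supports. *)
Lemma eval_HmonomEw (Hs : fps R[i] (n + n)) M D : (finsupp M `<=` D)%fset ->
  eval_Hmonom Hs M = \prod_(v <- D) Hs v ^+ M v.
Proof.
move=> sMD; rewrite /eval_Hmonom (big_fset_incl _ sMD) // => v _.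
by rewrite -cmE_eq0 => /eqP->; rewrite expr0.
Qed.

Lemma weightEw M D : (finsupp M `<=` D)%fset ->
  weight M = (\sum_(v <- D) v *+ M v)%MM.
Proof.
move=> sMD; rewrite /weight (big_fset_incl _ sMD) // => v _.
by rewrite -cmE_eq0 => /eqP->.
Qed.

Lemma mmorphism_eval_Hmonom (Hs : fps R[i] (n + n)) :
  mmorphism (eval_Hmonom Hs).
Proof.
split=> [M1 M2|]; last by rewrite /eval_Hmonom mdom1 big_seq_fset0.
rewrite (eval_HmonomEw _ (fsubsetUl (finsupp M1) (finsupp M2))).
rewrite (eval_HmonomEw _ (fsubsetUr (finsupp M1) (finsupp M2))).
rewrite /eval_Hmonom mdomD -big_split /=; apply: eq_bigr => v _.
by rewrite cmM exprD.
Qed.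

HB.instance Definition _ (Hs : fps R[i] (n + n)) :=
  isMultiplicative.Build (Hmonom n) R[i] (eval_Hmonom Hs)
    (mmorphism_eval_Hmonom Hs).

Lemma eval_HmonomU (Hs : fps R[i] (n + n)) v : eval_Hmonom Hs (ucm v) = Hs v.
Proof. by rewrite /eval_Hmonom mdomU big_seq_fset1 cmUU expr1. Qed.

Lemma weightM M1 M2 : weight (mmul M1 M2) = (weight M1 + weight M2)%MM.
Proof.
rewrite (weightEw (fsubsetUl (finsupp M1) (finsupp M2))).
rewrite (weightEw (fsubsetUr (finsupp M1) (finsupp M2))).
rewrite /weight mdomD -big_split /=; apply: eq_bigr => v _.
by rewrite cmM; apply/mnmP => i; rewrite mnmDE !mulmnE mulnDr.
Qed.

Lemma weightU v : weight (ucm v : Hmonom n) = v.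
Proof.
rewrite /weight mdomU big_seq_fset1 cmUU; apply/mnmP=> i.
by rewrite mulmnE muln1.
Qed.

Lemma mdeg_weight M (d : nat) : (forall v, v \in finsupp M -> (d <= mdeg v)%N) ->
  (d * monalg.mdeg M <= mdeg (weight M))%N.
Proof.
move=> hM; rewrite /weight mdeg_sum /monalg.mdeg big_distrr /= big_seq.
rewrite [X in (_ <= X)%N]big_seq.
apply: leq_sum => v /hM hv.
by rewrite mdegMn leq_mul.
Qed.

Lemma deltaD v1 v2 : delta (v1 + v2)%MM = delta v1 + delta v2.
Proof. by apply/rowP=> j; rewrite !mxE !mnmDE !PoszD; ring. Qed.

Lemma delta_pair (j : 'I_n) : delta (U_(xvar j) + U_(yvar j))%MM = 0.
Proof.
apply/rowP=> l; rewrite !mxE !mnmDE !mnm1E /xvar /yvar.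
by rewrite !eq_lshift !eq_rshift eq_lrshift eq_rlshift addn0 add0n subrr.
Qed.

End MonomialEvaluation.

(** * Orders of Poisson brackets, the bracket with [H_2], and the exponential series *)

Section PoissonBracket.
Variables (R : realType) (n : nat).
Notation C := R[i].
Implicit Types (F G : fps C (n + n)) (m : 'X_{1..n + n}) (lam : 'rV[C]_n).

Definition order_ge (d : nat) F := forall m, (mdeg m < d)%N -> F m = 0.

(** Each factor loses one degree by differentiation and [F] has order at least 3, so the product has
    order at least [2 + (d - 1)]. *)
Lemma order_ge_poisson d F G :
  in_calF F -> order_ge d G -> order_ge d.+1 (poisson F G).
Proof.
move=> hF hG m hm; rewrite /poisson big1 // => j _.
rewrite /fps_sub /fps_mul /fps_deriv !big1 ?subr0 // => i im.
all: have := congr1 mdeg (submK im); rewrite mdegD => em.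
all: have [hi|hi] := ltnP (mdeg i).+1 3;
  [by rewrite hF ?mdegD ?mdeg1 ?addn1 // mul0rn mul0r
  |rewrite hG ?mdegD ?mdeg1 ?addn1 ?mul0rn ?mulr0 //; lia].
Qed.

Lemma order_ge_iter_poisson d k F G :
  in_calF F -> order_ge d G -> order_ge (k + d) (iter k (poisson F) G).
Proof.
move=> hF hG; elim: k => [|k IH] //=.
by rewrite addSn; apply: order_ge_poisson.
Qed.

Lemma fps_mulDr F G1 G2 m :
  fps_mul F (fps_add G1 G2) m = fps_mul F G1 m + fps_mul F G2 m.
Proof.
by rewrite /fps_mul -big_split; apply: eq_bigr => i _; rewrite /fps_add mulrDr.
Qed.

Lemma eq_fps_mul F G1 G2 m : G1 =1 G2 -> fps_mul F G1 m = fps_mul F G2 m.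
Proof. by move=> eG; apply: eq_bigr => i _; rewrite eG. Qed.

Lemma poissonDr F G1 G2 m :
  poisson F (fps_add G1 G2) m = poisson F G1 m + poisson F G2 m.
Proof.
rewrite /poisson -big_split; apply: eq_bigr => j _; rewrite /fps_sub /=.
have derivD a : fps_deriv a (fps_add G1 G2)
    =1 fps_add (fps_deriv a G1) (fps_deriv a G2).
  by move=> i; rewrite /fps_deriv /fps_add mulrnDl.
by rewrite !(eq_fps_mul _ _ (derivD _)) !fps_mulDr; ring.
Qed.

(** With [G] equal to [c] times the variable [a], this is the Euler operator, which is diagonal on
    monomials. Only the index [m - U_(a)] contributes to the Cauchy product, and there is none when
    [m a = 0]. *)
Lemma fps_mul_deriv_var F G (c : C) a m :
    (forall i, G i = c *+ (i == U_(a))%MM) ->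
  fps_mul (fps_deriv a F) G m = c * F m *+ m a.
Proof.
move=> hG; rewrite /fps_mul.
have [ma0|ma0] := eqVneq (m a) 0%N.
  rewrite ma0 big1 // => i _; rewrite hG.
  case: eqP => [/mnmP/(_ a)|_]; last by rewrite mulr0.
  by rewrite mnmBE ma0 mnm1E eqxx.
have leU : (U_(a) <= m)%MM by rewrite lep1mP.
have bnd : (mdeg (m - U_(a))%MM < (mdeg m).+1)%N by rewrite ltnS mdegB.
rewrite (bigD1 (BMultinom bnd)) /= ?lem_subr // big1 => [|i /andP[im ni]].
  rewrite addr0 hG /fps_deriv submBA // [X in (X - m)%MM]addmC addmK eqxx.
  by rewrite submK // mnmBE mnm1E eqxx subn1 prednK ?lt0n // mulr1n mulrnAl mulrC.
rewrite hG; case: eqP => [e|_]; last by rewrite mulr0.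
case/eqP: ni; apply: val_inj => /=.
by rewrite -[in RHS](submK im) e addmC addmK.
Qed.

Lemma fps_deriv_H2 lam j m :
  (fps_deriv (xvar j) (H2 lam) m = lam 0 j *+ (m == U_(yvar j))%MM) *
  (fps_deriv (yvar j) (H2 lam) m = lam 0 j *+ (m == U_(xvar j))%MM).
Proof.
have xyF (l k : 'I_n) : (xvar l == yvar k) = false by exact: eq_lrshift.
have yxF (l k : 'I_n) : (yvar l == xvar k) = false by exact: eq_rlshift.
have xx (l k : 'I_n) : (xvar l == xvar k) = (l == k) by exact: eq_lshift.
have yy (l k : 'I_n) : (yvar l == yvar k) = (l == k) by exact: eq_rshift.
split; rewrite /fps_deriv /H2 (bigD1 j) //= big1 ?addr0 => [|l nlj].
- rewrite [X in X == _]addmC (inj_eq (@addmI _ _)).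
  by case: eqP => [->|_]; rewrite ?mul0rn // mnm1E yxF.
- case: eqP => // /mnmP/(_ (xvar j)).
  by rewrite !mnmDE !mnm1E !xx yxF eqxx (negPf nlj) addn1.
- rewrite (inj_eq (@addIm _ _)).
  by case: eqP => [->|_]; rewrite ?mul0rn // mnm1E xyF.
- case: eqP => // /mnmP/(_ (yvar j)).
  by rewrite !mnmDE !mnm1E !yy xyF eqxx (negPf nlj) addn1.
Qed.

(** The derivatives of [H_2] are [lam_j y_j] and [lam_j x_j], so the bracket is a combination of
    Euler operators with weights [lam_j] on [y_j] and [- lam_j] on [x_j]. *)
Lemma poisson_H2 lam F m : poisson F (H2 lam) m = pairing lam (delta m) * F m.
Proof.
rewrite /poisson /pairing mulr_suml; apply: eq_bigr => j _; rewrite /fps_sub.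
rewrite (fps_mul_deriv_var _ _ (fun i => (fps_deriv_H2 lam j i).1)).
rewrite (fps_mul_deriv_var _ _ (fun i => (fps_deriv_H2 lam j i).2)).
by rewrite mxE intrB -!pmulrn -![_ * _ *+ _]mulr_natr; ring.
Qed.

Lemma in_calF_poisson_H2D lam F G :
  in_calF F -> in_calF G -> in_calF (poisson F (fps_add (H2 lam) G)).
Proof.
move=> hF hG; apply: (@order_ge_poisson 2) => // m hm.
rewrite /fps_add hG ?(ltn_trans hm) // addr0 /H2 big1 // => j _.
by case: eqP => // em; rewrite em mdegD !mdeg1 in hm.
Qed.

(** Since [G] has order at least 3, its bracket iterated [k.+1] times has order at least [k + 4]. At
    [m] the terms with [k >= mdeg m] vanish and the limit is a finite sum. *)
Lemma normal_form_eq lam F Hs Ns m :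
    in_calF F -> in_calF Hs ->
    is_exp_poisson F (fps_add (H2 lam) Hs) (fps_add (H2 lam) Ns) ->
  let G := poisson F (fps_add (H2 lam) Hs) in
  Ns m = Hs m + G m
    + \sum_(k < mdeg m) (k.+2`!%:R)^-1 * iter k.+1 (poisson F) G m.
Proof.
move=> hF hHs /(_ m)[K0 hK] G.
have hG := in_calF_poisson_H2D lam hF hHs.
(* This partial sum is past the stabilization threshold and contains every nonzero term; the extra 2
   accounts for the terms of index 0 and 1, split off next. *)
have := hK (maxn K0 (mdeg m)).+2; rewrite !leqW ?leq_maxl // => /(_ isT).
rewrite 2!big_ord_recl /= fact0 invr1 !mul1r /fps_add -addrA -addrA.
move/addrI => <-; congr (_ + _); congr (_ + _).
rewrite (big_ord_widen _ (fun k => (k.+2`!%:R)^-1 * iter k.+1 (poisson F) G m)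
  (leq_maxr K0 (mdeg m))) [RHS]big_mkcond; apply: eq_bigr => k _.
rewrite [bump 0 (bump 0 k)]/= /bump !add1n -iterS iterSr -/G.
case: ltnP => // mk; apply/eqP; rewrite mulf_eq0; apply/orP; right; apply/eqP.
by apply: (order_ge_iter_poisson (k := k.+1) hF hG); rewrite ltn_addr.
Qed.

End PoissonBracket.

(** * Families of series whose coefficients are polynomials with the weight condition *)

Section PolynomialCoefficients.
Variables (R : realType) (n : nat) (X : Type).
Notation C := R[i].
Variable Hs : X -> fps C (n + n).
Hypothesis calF_Hs : forall x, in_calF (Hs x).
Implicit Types (M : Hmonom n) (m : 'X_{1..n + n}) (f g : X -> C).

(** The upper bound on the degree is left out because it follows from the other conditions, see
    [admissible_degree]. *)
Definition admissible m M :=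
  [/\ forall v : 'X_{1..n + n}, v \in finsupp M -> (3 <= mdeg v)%N,
      (1 <= monalg.mdeg M)%N
    & exists T : 'X_{1..n + n},
        [/\ weight M = (m + T)%MM,
            delta T = 0
          & mdeg T = (2 * monalg.mdeg M - 2)%N]].

(** Every factor of [M] has an index of degree at least 3, so
    [3 deg M <= |w(M)| = |m| + 2 deg M - 2]. *)
Lemma admissible_degree m M : admissible m M -> (monalg.mdeg M <= mdeg m - 2)%N.
Proof.
case=> hM M0 [T [wM _ dT]]; have := mdeg_weight hM.
by rewrite wM mdegD dT; lia.
Qed.

Lemma admissibleM m m1 m2 j M1 M2 :
    (m1 + m2)%MM = (m + (U_(xvar j) + U_(yvar j)))%MM ->
  admissible m1 M1 -> admissible m2 M2 -> admissible m (mmul M1 M2).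
Proof.
move=> em [s1 d1 [T1 [w1 t1 e1]]] [s2 d2 [T2 [w2 t2 e2]]].
split=> [v||]; first by rewrite mdomD in_fsetU => /orP[/s1|/s2].
  by rewrite monalg.mdegM; lia.
(* The pair [x_j y_j] lost in the bracket joins the excess. Its degree 2 makes up the count [2 + (2
   d1 - 2) + (2 d2 - 2) = 2 (d1 + d2) - 2]; as [d1] and [d2] are positive, the truncated
   subtractions are exact. *)
exists (U_(xvar j) + U_(yvar j) + (T1 + T2))%MM; split.
- rewrite weightM w1 w2; apply/mnmP=> i; move/mnmP/(_ i): em.
  by rewrite !mnmDE; lia.
- by rewrite deltaD [delta (T1 + T2)%MM]deltaD t1 t2 delta_pair !addr0.
- by rewrite !mdegD !mdeg1 monalg.mdegM e1 e2; lia.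
Qed.

(* [X] indexes the normalization data [(F, Hs, Ns)], so that one polynomial
   serves all of them; the weight of [f] is prescribed to be [m]. *)
Definition hpoly m f := exists p : Hpoly R n,
  (forall M, M \in monalg.msupp p -> admissible m M) /\
  forall x, f x = eval_Hpoly (Hs x) p.

Lemma eq_hpoly m f g : f =1 g -> hpoly m g -> hpoly m f.
Proof. by move=> efg [p [hp eg]]; exists p; split=> // x; rewrite efg. Qed.

Lemma hpoly0 m : hpoly m (fun=> 0).
Proof.
exists 0; split=> [M|x]; first by rewrite monalg.msupp0.
by rewrite /eval_Hpoly monalg.mmap0.
Qed.

Lemma hpolyD m f g : hpoly m f -> hpoly m g -> hpoly m (fun x => f x + g x).
Proof.
move=> [p [hp ef]] [q [hq eg]]; exists (p + q); split=> [M|x].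
  by move/(fsubsetP (monalg.msuppD_le _ _)); rewrite in_fsetU => /orP[/hp|/hq].
by rewrite ef eg /eval_Hpoly monalg.mmapD.
Qed.

Lemma hpolyZ m c f : hpoly m f -> hpoly m (fun x => c * f x).
Proof.
move=> [p [hp ef]]; exists (c *: p); split=> [M|x].
  by move/(fsubsetP (monalg.msuppZ_le _ _))/hp.
by rewrite ef /eval_Hpoly monalg.mmapZ.
Qed.

Lemma hpoly_sum m (I : Type) (r : seq I) (P : pred I) (F : I -> X -> C) :
    (forall i, P i -> hpoly m (F i)) ->
  hpoly m (fun x => \sum_(i <- r | P i) F i x).
Proof.
move=> hF; elim: r => [|i r IH].
  by apply: eq_hpoly (hpoly0 m) => x; rewrite big_nil.
have [Pi|nPi] := boolP (P i).
  by apply: eq_hpoly (hpolyD (hF i Pi) IH) => x; rewrite big_cons Pi.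
by apply: eq_hpoly IH => x; rewrite big_cons (negPf nPi).
Qed.

Lemma hpolyM m m1 m2 j f g :
    (m1 + m2)%MM = (m + (U_(xvar j) + U_(yvar j)))%MM ->
  hpoly m1 f -> hpoly m2 g -> hpoly m (fun x => f x * g x).
Proof.
move=> em [p [hp ef]] [q [hq eg]]; exists (p * q); split=> [M|x].
  case/monalg.msuppM_le => M1 [M2 [/hp h1 /hq h2 ->]].
  exact: admissibleM em h1 h2.
by rewrite ef eg /eval_Hpoly rmorphM.
Qed.

Lemma hpoly_Hs m : hpoly m (fun x => Hs x m).
Proof.
have [lt3|ge3] := ltnP (mdeg m) 3.
  by apply: eq_hpoly (hpoly0 m) => x; rewrite calF_Hs.
exists << 1 *g ucm m >>; split=> [M|x].
  rewrite monalg.msuppU1 in_fset1 => /eqP->; split=> [v||].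
  - by rewrite mdomU in_fset1 => /eqP->.
  - by rewrite monalg.mdegU.
  - exists 0%MM; rewrite weightU addm0 monalg.mdegU mpoly.mdeg0; split=> //.
    by apply/rowP=> j; rewrite !mxE !mnm0E subrr.
by rewrite /eval_Hpoly monalg.mmapU /= mul1r eval_HmonomU.
Qed.

(** The two coefficients in a term have indices of total degree [mdeg m + 2]. Unless the term
    vanishes, each index has degree at least 3, hence the other has degree at most [mdeg m - 1].
    This is the gain from [d] to [d.+1]. *)
Lemma hpoly_poisson d (F G : X -> fps C (n + n)) :
    (forall x, in_calF (F x)) -> (forall x, in_calF (G x)) ->
    (forall m, (mdeg m < d)%N -> hpoly m (fun x => F x m)) ->
    (forall m, (mdeg m < d)%N -> hpoly m (fun x => G x m)) ->
  forall m, (mdeg m < d.+1)%N -> hpoly m (fun x => poisson (F x) (G x) m).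
Proof.
move=> calF_F calF_G hF hG m hm; rewrite /poisson /fps_sub /fps_mul /fps_deriv.
(* Taking [(a, b)] as [(y_j, x_j)] or [(x_j, y_j)] covers both halves of the bracket. *)
have hterm j a b (i : 'X_{1..n + n}) : (i <= m)%MM ->
    (U_(a) + U_(b) = U_(xvar j) + U_(yvar j) :> 'X_{1..n + n})%MM ->
    hpoly m (fun x => F x (i + U_(a))%MM *+ (i a).+1 *
                      (G x (m - i + U_(b))%MM *+ ((m - i)%MM b).+1)).
  move=> im eab; have em := submK im.
  have edeg := congr1 mdeg em; rewrite mdegD in edeg.
  have [lt3|ge3] := ltnP (mdeg (i + U_(a))%MM) 3.
    by apply: eq_hpoly (hpoly0 m) => x; rewrite calF_F // mul0rn mul0r.
  have [lt3'|ge3'] := ltnP (mdeg (m - i + U_(b))%MM) 3.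
    by apply: eq_hpoly (hpoly0 m) => x; rewrite calF_G // mul0rn mulr0.
  rewrite mdegD mdeg1 in ge3; rewrite mdegD mdeg1 in ge3'.
  have hFi : hpoly (i + U_(a))%MM (fun x => F x (i + U_(a))%MM).
    by apply: hF; rewrite mdegD mdeg1; lia.
  have hGi : hpoly (m - i + U_(b))%MM (fun x => G x (m - i + U_(b))%MM).
    by apply: hG; rewrite mdegD mdeg1; lia.
  have eFG : (i + U_(a) + (m - i + U_(b)) = m + (U_(xvar j) + U_(yvar j)))%MM.
    by rewrite -eab -[in RHS]em; apply/mnmP=> l; rewrite !mnmDE; lia.
  apply: eq_hpoly (hpolyZ (((m - i)%MM b).+1 * (i a).+1)%:R
    (hpolyM eFG hFi hGi)) => x.
  by rewrite mulr_natl mulrnA mulrnAl mulrnAr.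
apply: hpoly_sum => j _; apply: hpolyD.
  by apply: hpoly_sum => i im; apply: (hterm j) => //; rewrite addmC.
apply: eq_hpoly
  (hpolyZ (-1) (hpoly_sum _ (fun i im => hterm j _ _ _ im erefl))) => x.
by rewrite mulN1r.
Qed.

Lemma hpoly_iter_poisson d k (F G : X -> fps C (n + n)) :
    (forall x, in_calF (F x)) -> (forall x, in_calF (G x)) ->
    (forall m, (mdeg m < d)%N -> hpoly m (fun x => F x m)) ->
    (forall m, (mdeg m < d)%N -> hpoly m (fun x => G x m)) ->
  forall m, (mdeg m < d.+1)%N ->
    hpoly m (fun x => iter k.+1 (poisson (F x)) (G x) m).
Proof.
move=> calF_F calF_G hF hG; elim: k => [|k IH] m hm.
  exact: hpoly_poisson hm.
apply: (@hpoly_poisson d _ (fun x => iter k.+1 (poisson (F x)) (G x))) hm => //.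
  move=> x v hv.
  by rewrite (order_ge_iter_poisson (calF_F x) (calF_G x)) // ltn_addl.
by move=> v hv; apply: IH; rewrite ltnS ltnW.
Qed.

(** * The homological equation and the induction on the degree *)

Variables (lam : 'rV[C]_n) (F Ns : X -> fps C (n + n)).
Hypothesis normF : forall x, normalizes lam (F x) (Hs x) (Ns x).

(** In degree at most [d], the coefficient [F_m] enters the equation for [N_m] only through
    [{F, H_2}]. Once that term is moved to the left, the right side involves only [H_*] and
    coefficients of [F] of degree below [d]. *)
Lemma hpoly_homological d :
    (forall m, (mdeg m < d)%N -> hpoly m (fun x => F x m)) ->
  forall m, (mdeg m < d.+1)%N ->
    hpoly m (fun x => Ns x m - pairing lam (delta m) * F x m).
Proof.
move=> hF m hm; have calF_F x : in_calF (F x) by case: (normF x).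
pose G x := poisson (F x) (fps_add (H2 lam) (Hs x)).
have GE x v : G x v = pairing lam (delta v) * F x v + poisson (F x) (Hs x) v.
  by rewrite /G poissonDr poisson_H2.
have hbr := hpoly_poisson calF_F calF_Hs hF (fun v _ => hpoly_Hs v).
(* Below degree [d] the linear term of [G] is already under control, which suffices for the iterated
   brackets up to degree [d]. *)
have hG v : (mdeg v < d)%N -> hpoly v (fun x => G x v).
  move=> hv; apply: eq_hpoly (fun x => GE x v) _.
  by apply: hpolyD; [apply/hpolyZ/hF|apply: hbr; rewrite ltnS ltnW].
pose S x := \sum_(k < mdeg m) (k.+2`!%:R)^-1 * iter k.+1 (poisson (F x)) (G x) m.
have hS : hpoly m S.
  apply: hpoly_sum => k _; apply: hpolyZ.
  exact: (hpoly_iter_poisson k calF_F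
    (fun x => in_calF_poisson_H2D lam (calF_F x) (calF_Hs x)) hF hG).
apply: eq_hpoly (hpolyD (hpolyD (hpoly_Hs m) (hbr m hm)) hS) => x.
have [_ _ _ _ /(normal_form_eq m (calF_F x) (calF_Hs x))->] := normF x.
by rewrite -/(G x) -/(S x) GE; ring.
Qed.

(** At a resonant [m] the coefficient of [F] is zero by normalization. Otherwise [N_m = 0] and the
    homological equation is solved for [F_m] by dividing by the nonzero [<lam, delta m>]. *)
Lemma hpoly_generator m : hpoly m (fun x => F x m).
Proof.
have [d] := ubnP (mdeg m); elim: d m => // d IH m hm.
have hN := hpoly_homological IH hm.
have [res|nres] := boolP (resonant lam m).
  by apply: eq_hpoly (hpoly0 m) => x; have [_ -> //] := normF x.
apply: eq_hpoly (hpolyZ (- (pairing lam (delta m))^-1) hN) => x.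
have [_ _ _ -> // _] := normF x.
by rewrite sub0r mulrNN mulKf.
Qed.

Lemma hpoly_normal_form m : resonant lam m -> hpoly m (fun x => Ns x m).
Proof.
move=> /eqP res.
apply: eq_hpoly
  (hpoly_homological (fun v _ => hpoly_generator v) (ltnSn _)) => x.
by rewrite res mul0r subr0.
Qed.

End PolynomialCoefficients.

Theorem theorem2 (R : realType) (n : nat) (hn : (1 <= n)%N)
    (lam : 'rV[R[i]]_n) (ab : 'X_{1..n + n})
    (hres : pairing lam (delta ab) = 0) (hdeg : (3 <= mdeg ab)%N) :
  exists p : Hpoly R n,
    (forall M : Hmonom n, M \in monalg.msupp p ->
       [/\ forall v : 'X_{1..n + n}, v \in finsupp M -> (3 <= mdeg v)%N,
           (1 <= monalg.mdeg M <= mdeg ab - 2)%N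
         & exists T : 'X_{1..n + n},
             [/\ weight M = (ab + T)%MM,
                 delta T = 0
               & mdeg T = (2 * monalg.mdeg M - 2)%N]]) /\
    (forall Hs Ns : fps R[i] (n + n),
       in_calF Hs -> is_normal_form lam Hs Ns ->
       Ns ab = eval_Hpoly Hs p).
Proof.
(* Taking all normalization data for [lam] at once as index type yields a polynomial that does not
   depend on [H_*]. *)
pose X := {t : fps R[i] (n + n) * fps R[i] (n + n) * fps R[i] (n + n) |
  in_calF t.1.2 /\ normalizes lam t.1.1 t.1.2 t.2}.
have [p [hp ep]] := @hpoly_normal_form R n X (fun x => (sval x).1.2)
  (fun x => (svalP x).1) lam (fun x => (sval x).1.1) (fun x => (sval x).2)
  (fun x => (svalP x).2) ab (introT eqP hres).
exists p; split=> [M /hp hM|Hs Ns calF_Hs [F normF]].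
  by have leM := admissible_degree hM; case: hM => ? -> ?; split.
exact: (ep (exist _ (F, Hs, Ns) (conj calF_Hs normF))).
Qed.
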